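(* Let $T\ge1$, $n\ge1$ with $nT\ge2$, $\mu\in\mathbb{R}$, $\sigma>0$, $z^*\in\mathbb{R}$, $\tau\in\{1,\dots,T\}$. Under $\mathbf{H_0}$ the real numbers $X_{t,k}$ ($t\le T$, $k\le n$) are i.i.d. $\mathcal{N}(\mu,\sigma^2)$; under $\mathbf{H_1^\tau}$ they are generated the same way and then $X_{\tau,J}$ is replaced by $z^*$, with $J$ uniform on $\{1,\dots,n\}$ independent of the data. Let $\hat\mu_T=\frac{1}{nT}\sum_{t=1}^T\sum_{k=1}^nX_{t,k}$, $W=\hat\mu_T-\mu$, and define the final-observation statistic \[ L_{\mathrm{FO}}=-\frac12\log\Big(\frac{nT-1}{nT}\Big)-\frac{nT}{2(nT-1)\sigma^2}W^2+\frac{nT(z^*-\mu)}{(nT-1)\sigma^2}W-\frac{(z^*-\mu)^2}{2(nT-1)\sigma^2}. \] Let $\alpha_{\mathrm{FO}}(\gamma)=\mathbb{P}_{\mathbf{H_0}}(L_{\mathrm{FO}}\ge\gamma)$, $\gamma^{(T)}_{\max}=\frac12\big[\frac{(z^*-\mu)^2}{\sigma^2}-\log\big(\frac{nT-1}{nT}\big)\big]$, $m^*=\frac{(z^*-\mu)^2}{\sigma^2}$, $a_T=\sqrt{m^*nT}$, and $b_T(\gamma)=\sqrt{(nT-1)\big(m^*-\log(1-\frac1{nT})-2\gamma\big)}$. Then for every $\gamma\le\gamma^{(T)}_{\max}$, \[ \alpha_{\mathrm{FO}}(\gamma)=\Phi(a_T+b_T(\gamma))-\Phi(a_T-b_T(\gamma)),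 \] where $\Phi$ is the standard normal cumulative distribution function.
   Context: $L_{\mathrm{FO}}$ is the log likelihood ratio statistic of a membership test that only observes the final cumulative mean $\hat\mu_T$; $\alpha_{\mathrm{FO}}(\gamma)$ is its Type I error at threshold $\gamma$. *)

(* Defs.v *)
From HB Require Import structures.
From mathcomp Require Import all_boot all_order all_algebra.
From mathcomp Require Import all_classical all_reals all_analysis.
Set Implicit Arguments. Unset Strict Implicit. Unset Printing Implicit Defensive.
Import Order.TTheory GRing.Theory Num.Theory.
Import numFieldNormedType.Exports.
Local Open Scope classical_set_scope.
Local Open Scope ring_scope.

(* Standard normal cumulative distribution function:
   Phi x = P(N(0,1) <= x), via the library's normal probability measure
   (normal_prob m s = law of N(m, s^2), s the standard deviation). *)
Definition Phi {R : realType} (x : R) : R :=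
  fine (normal_prob (0:R) 1 `]-oo, x]).

Definition mutually_independent {R : realType} d (Omega : measurableType d)
  (P : probability Omega R) (I : finType) (X : I -> {RV P >-> R}) : Prop :=
  forall (J : {set I}) (B : I -> set R),
    (forall i, measurable (B i)) ->
    P [set w | forall i, i \in J -> B i (X i w)] =
    (\prod_(i in J) P (X i @^-1` B i))%E.

(* The final-observation log-likelihood-ratio statistic L_FO as a function of
   W = muhat_T - mu, with N = n T. *)
Definition L_FO {R : realType} (N : nat) (mu sigma zstar W : R) : R :=
  - (1/2) * ln ((N%:R - 1) / N%:R)
  - N%:R / (2 * (N%:R - 1) * sigma ^+ 2) * W ^+ 2
  + N%:R * (zstar - mu) / ((N%:R - 1) * sigma ^+ 2) * W
  - (zstar - mu) ^+ 2 / (2 * (N%:R - 1) * sigma ^+ 2).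

Definition muhat {R : realType} d (Omega : measurableType d)
  (P : probability Omega R) (T n : nat)
  (X : 'I_T * 'I_n -> {RV P >-> R}) (w : Omega) : R :=
  (n * T)%:R^-1 * \sum_(i : 'I_T * 'I_n) X i w.

Definition gamma_max {R : realType} (N : nat) (mu sigma zstar : R) : R :=
  (1/2) * ((zstar - mu) ^+ 2 / sigma ^+ 2 - ln ((N%:R - 1) / N%:R)).

Definition mstar {R : realType} (mu sigma zstar : R) : R :=
  (zstar - mu) ^+ 2 / sigma ^+ 2.

Definition a_T {R : realType} (N : nat) (mu sigma zstar : R) : R :=
  Num.sqrt (mstar mu sigma zstar * N%:R).

Definition b_T {R : realType} (N : nat) (mu sigma zstar gamma : R) : R :=
  Num.sqrt ((N%:R - 1) *
    (mstar mu sigma zstar - ln (1 - N%:R^-1) - 2 * gamma)).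

(* Main.v *)
Require Import Defs.
From HB Require Import structures.
From mathcomp Require Import all_boot all_order all_algebra.
From mathcomp Require Import all_classical all_reals all_analysis.
From mathcomp Require Import measurable_realfun ring lra.
Import Order.TTheory GRing.Theory Num.Theory.
Local Open Scope classical_set_scope.
Local Open Scope ring_scope.

(** The sum of independent normal variables is normal: the law of a pair of
    independent variables is a product measure, and by Tonelli the convolution
    of two normal laws reduces to completing the square in the product of their
    densities. Hence [muhat - mu] is a centred normal variable of variance
    [sigma^2 / (n T)]. As a function of [W], the statistic [L_FO] is
    [gamma_max - n T (W - (zstar - mu))^2 / (2 (n T - 1) sigma^2)], so that
    [gamma <= L_FO] says that the standardized mean lies in an interval of
    radius [b_T] centred at [a_T] or [- a_T]; both intervals have the same
    standard normal probability. *)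

(** * Lebesgue measure and integrals under affine maps *)

Section affine_change_of_variables.
Context {R : realType}.
Local Notation leb := (@lebesgue_measure R).
Variables (c d : R).
Hypothesis c0 : c != 0.

Let aff (x : measurableTypeR R) : measurableTypeR R := c * x + d.

Let measurable_aff : measurable_fun setT aff.
Proof. by apply: measurable_funD. Qed.

Let preimage_aff_itv a b :
  leb (aff @^-1` `]a, b]%classic) = ((`|c|^-1)%:E * leb `]a, b]%classic)%E.
Proof.
have [cp|cn|ce] := ltgtP 0 c; last by move: c0; rewrite -ce eqxx.
- have -> : aff @^-1` `]a, b] = `](a - d) / c, (b - d) / c]%classic.
    apply/seteqP; split=> x /=; rewrite !in_itv/= /aff;
      by rewrite ltr_pdivrMr// ler_pdivlMr// ltrBlDr lerBrDr (mulrC x).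
  rewrite !lebesgue_measure_itv/= !lte_fin ltr_pM2r ?invr_gt0// ltrD2r.
  case: ifPn => _; last by rewrite mule0.
  by rewrite -!EFinB -EFinM gtr0_norm//; congr EFin; field.
(* For negative [c] the endpoints swap and the closed end moves to the left; the length does not
   depend on which end is closed. *)
- have -> : aff @^-1` `]a, b] = `[(b - d) / c, (a - d) / c[%classic.
    apply/seteqP; split=> x /=; rewrite !in_itv/= /aff andbC;
      by rewrite ltr_ndivlMr// ler_ndivrMr// ltrBlDr lerBrDr (mulrC x).
  rewrite !lebesgue_measure_itv/= !lte_fin ltr_nM2r ?invr_lt0// ltrD2r.
  case: ifPn => _; last by rewrite mule0.
  by rewrite -!EFinB -EFinM ltr0_norm//; congr EFin; field.
Qed.

(** Both sides are measures in [A] that agree on half-open intervals, hence everywhere by uniqueness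
    of Lebesgue measure. *)
Lemma lebesgue_measure_affine (A : set R) : measurable A ->
  leb A = (`|c|%:E * leb ((fun x => c * x + d)%R @^-1` A))%E.
Proof.
move=> mA.
rewrite (@lebesgue_measure_unique _ (mscale `|c|%:nng (pushforward leb aff)))//.
move=> _ [[a b]] _ <-.
rewrite -[RHS]/(`|c|%:E * leb (aff @^-1` `]a, b]%classic))%E.
by rewrite preimage_aff_itv muleA -EFinM divff ?normr_eq0// mul1e.
Qed.

Lemma ge0_integral_affine (A : set R) (f : R -> \bar R) :
  measurable A -> measurable_fun A f -> (forall x, 0 <= f x)%E ->
  (\int[leb]_(y in A) f y =
   \int[leb]_(x in (fun x => c * x + d)%R @^-1` A)
     (`|c|%:E * f (c * x + d)%R))%E.
Proof.
move=> mA mf f0.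
have mpA : measurable (aff @^-1` A).
  by rewrite -[_ @^-1` _]setTI; exact: measurable_aff.
rewrite ge0_integralZl//; last first.
  apply: (measurable_comp mA _ mf) => [_ [x Ax <-]//|].
  exact: measurable_funTS.
rewrite [LHS](eq_measure_integral (mscale `|c|%:nng (pushforward leb aff)));
  last first.
  by move=> B mB _; rewrite [LHS]lebesgue_measure_affine.
by rewrite ge0_integral_mscale// ge0_integral_pushforward// => x _.
Qed.

End affine_change_of_variables.

(** * Normal laws: standardization, integration, convolution *)

Section normal_prob_lemmas.
Context {R : realType}.
Local Notation leb := (@lebesgue_measure R).
Implicit Types m s : R.

Lemma eq_normal_prob m s t (A : set R) : s ^+ 2 = t ^+ 2 ->
  normal_prob m s A = normal_prob m t A.
Proof.
move=> st; rewrite /normal_prob; apply: eq_integral => x _; congr EFin.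
(* [normal_pdf] branches on [s == 0]; the test is moved to the square so that [st] applies to it
   too. *)
by rewrite /normal_pdf -sqrf_eq0 st sqrf_eq0 /normal_peak /normal_fun st.
Qed.

Lemma normal_pdf_standardize m s x : s != 0 ->
  normal_pdf m s x = `|s|^-1 * normal_pdf 0 1 ((x - m) / s).
Proof.
move=> s0; rewrite !normal_pdfE ?oner_neq0// /normal_peak /normal_fun mulrA.
congr (_ * expR _); last by field.
rewrite -mulrnAr sqrtrM ?sqr_ge0// sqrtr_sqr invfM.
by rewrite expr1n mul1r.
Qed.

Lemma normal_prob_standardize m s (A : set R) : s != 0 -> measurable A ->
  normal_prob m s ((fun x => (x - m) / s) @^-1` A) = normal_prob 0 1 A.
Proof.
move=> s0 mA; rewrite /normal_prob.
rewrite [RHS](@ge0_integral_affine _ s^-1 (- m / s))//.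
- have -> : (fun x : R => s^-1 * x + - m / s) = (fun x => (x - m) / s).
    by apply/funext => x; ring.
  apply: eq_integral => x _; rewrite normal_pdf_standardize// EFinM normfV.
  by congr (_ * (normal_pdf _ _ _)%:E)%E; ring.
- by rewrite invr_eq0.
- apply/measurable_EFinP/measurable_funTS; exact: measurable_normal_pdf.
- by move=> x; rewrite lee_fin normal_pdf_ge0.
Qed.

(** [normal_pdf] and the Radon-Nikodym derivative of the normal law have equal integrals over every
    measurable set, so they agree almost everywhere. *)
Lemma ge0_integral_normal_prob m s (f : R -> \bar R) :
  measurable_fun setT f -> (forall x, 0 <= f x)%E ->
  (\int[normal_prob m s]_x f x = \int[leb]_x (f x * (normal_pdf m s x)%:E))%E.
Proof.
move=> mf f0.
have mpdf : measurable_fun setT (fun x => (normal_pdf m s x)%:E).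
  by apply/measurable_EFinP; exact: measurable_normal_pdf.
have dom := @normal_prob_dominates R m s.
rewrite -(Radon_Nikodym_SigmaFinite.change_of_variables dom)//.
have iRN := Radon_Nikodym_SigmaFinite.f_integrable dom.
have mRN := measurable_int _ iRN.
apply: ae_eq_integral => //; [exact: emeasurable_funM.. |].
apply: ae_eqe_mul2l; apply: integral_ae_eq => // A _ mA.
by rewrite -Radon_Nikodym_SigmaFinite.f_integral.
Qed.

(** With [x] the first summand and [z] the sum, the joint density is the density of the sum times
    the conditional density of the first summand given the sum. *)
Lemma normal_pdf_mul m1 s1 m2 s2 x z : s1 != 0 -> s2 != 0 ->
  let s := Num.sqrt (s1 ^+ 2 + s2 ^+ 2) in
  normal_pdf m1 s1 x * normal_pdf m2 s2 (z - x) =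
  normal_pdf (m1 + m2) s z *
  normal_pdf ((m1 * s2 ^+ 2 + (z - m2) * s1 ^+ 2) / s ^+ 2) (s1 * s2 / s) x.
Proof.
move=> s10 s20 s.
have p1 : 0 < s1 ^+ 2 by rewrite exprn_even_gt0.
have p2 : 0 < s2 ^+ 2 by rewrite exprn_even_gt0.
have p : 0 < s1 ^+ 2 + s2 ^+ 2 by rewrite addr_gt0.
have s0 : s != 0 by rewrite gt_eqF// sqrtr_gt0.
have sE : s ^+ 2 = s1 ^+ 2 + s2 ^+ 2 by rewrite sqr_sqrtr// ltW.
have e2 : (s1 * s2 / s) ^+ 2 = s1 ^+ 2 * s2 ^+ 2 / (s1 ^+ 2 + s2 ^+ 2).
  by rewrite exprMn exprVn sE exprMn.
rewrite !normal_pdfE ?mulf_neq0 ?invr_eq0//.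
rewrite /normal_peak /normal_fun e2 sE.
rewrite [LHS]mulrACA [RHS]mulrACA -!expRD.
congr (_ * expR _); last first.
  by field; rewrite s10 s20 gt_eqF.
rewrite -!invfM; congr (_^-1).
have peak_ge0 (t : R) : 0 < t -> 0 <= t * pi *+ 2.
  by move=> t0; rewrite mulrn_wge0// mulr_ge0 ?pi_ge0// ltW.
rewrite -(sqrtrM _ (peak_ge0 _ p1)) -(sqrtrM _ (peak_ge0 _ p)).
congr Num.sqrt; field.
by rewrite gt_eqF.
Qed.


Lemma normal_prob_convolution m1 s1 m2 s2 (A : set R) :
  s1 != 0 -> s2 != 0 -> measurable A ->
  (normal_prob m1 s1 \x normal_prob m2 s2)%E [set z : R * R | A (z.1 + z.2)] =
  normal_prob (m1 + m2) (Num.sqrt (s1 ^+ 2 + s2 ^+ 2)) A.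
Proof.
move=> s10 s20 mA.
set s := Num.sqrt _.
(* [p.1] is the first summand and [p.2] the sum, so that Tonelli can integrate out the summand for a
   fixed sum. *)
pose f (p : R * R) : \bar R :=
  (\1_A p.2 * (normal_pdf m1 s1 p.1 * normal_pdf m2 s2 (p.2 - p.1)))%:E.
have f0 p : (0 <= f p)%E by rewrite lee_fin !mulr_ge0// normal_pdf_ge0.
have mf : measurable_fun setT f.
  apply/measurable_EFinP; apply: measurable_funM.
    by apply: (measurableT_comp (measurable_indic mA)); exact: measurable_snd.
  apply: measurable_funM.
    apply: (measurableT_comp (measurable_normal_pdf _ _)).
    exact: measurable_fst.
  apply: (measurableT_comp (measurable_normal_pdf _ _)).
  by apply: measurable_funB; [exact: measurable_snd|exact: measurable_fst].
have mE : measurable [set z : R * R | A (z.1 + z.2)].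
  rewrite -[X in measurable X]setTI.
  by apply: (@measurable_funD _ _ _ _ fst snd).
have secE x : normal_prob m2 s2 (xsection [set z : R * R | A (z.1 + z.2)] x) =
    (\int[leb]_z (\1_A z * normal_pdf m2 s2 (z - x))%:E)%E.
  rewrite [LHS](@ge0_integral_affine _ 1 (- x)).
  - have -> : (fun z : R => 1 * z - x) @^-1`
        xsection [set z : R * R | A (z.1 + z.2)] x = A.
      apply/seteqP; split=> z; rewrite /xsection/= inE/=;
        by rewrite mul1r addrC subrK.
    rewrite integral_mkcond; apply: eq_integral => z _.
    rewrite patchE indicE; case: ifPn => _; last by rewrite mul0r.
    by rewrite normr1 mul1e !mul1r.
  - exact: oner_neq0.
  - exact: measurable_xsection.
  - by apply/measurable_EFinP/measurable_funTS; exact: measurable_normal_pdf.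
  - by move=> y; rewrite lee_fin normal_pdf_ge0.
transitivity (\int[leb]_x \int[leb]_z f (x, z))%E.
  rewrite [LHS]ge0_integral_normal_prob//=; last first.
    exact: measurable_fun_xsection.
  apply: eq_integral => x _; rewrite secE.
  rewrite -ge0_integralZr//.
  - by apply: eq_integral => z _; rewrite -EFinM /f/=; congr EFin; ring.
  - apply/measurable_EFinP; apply: measurable_funM.
      exact: measurable_indic.
    apply: (measurableT_comp (measurable_normal_pdf _ _)).
    exact: measurable_funB.
  - by move=> z _; rewrite lee_fin mulr_ge0// normal_pdf_ge0.
  - by rewrite lee_fin normal_pdf_ge0.
rewrite fubini_tonelli// [RHS]integral_mkcond.
apply: eq_integral => z _; rewrite patchE /f/= indicE.
case: ifPn => _; last by rewrite integral0_eq// => x _; rewrite mul0r.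
(* For a fixed sum, the conditional density has total mass one. *)
under eq_integral do rewrite mul1r normal_pdf_mul// EFinM.
rewrite ge0_integralZl//.
- by rewrite integral_normal_pdf mule1.
- by apply/measurable_EFinP; exact: measurable_normal_pdf.
- by move=> x _; rewrite lee_fin normal_pdf_ge0.
- by rewrite lee_fin normal_pdf_ge0.
Qed.

End normal_prob_lemmas.

(** * Law of a finite sum of independent normal variables *)

Section sum_of_independent_normals.
Context {R : realType} {d : measure_display} {Omega : measurableType d}.
Context {P : probability Omega R} {I : finType}.
Variables (X : I -> {RV P >-> R}) (m s : I -> R).

Hypothesis indepX : mutually_independent X.
Hypothesis s_neq0 : forall i, s i != 0.
Hypothesis lawX : forall i (A : set R), measurable A ->
  distribution P (X i) A = normal_prob (m i) (s i) A.

Let cyl (K : {set I}) (B : I -> set R) : set Omega :=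
  [set w | forall k, k \in K -> B k (X k w)].

Let measurable_cyl K B : (forall i, measurable (B i)) -> measurable (cyl K B).
Proof.
move=> mB.
have -> : cyl K B = \bigcap_(k in [set k | k \in K]) (X k @^-1` B k).
  by apply/seteqP; split=> w /=; exact.
apply: fin_bigcap_measurable; first exact: finite_finpred.
by move=> k _; rewrite -[X in measurable X]setTI; exact: measurable_funP.
Qed.

(** Imposing a condition on a fresh index keeps the event a cylinder, to which independence applies
    directly. *)
Let upd (B : I -> set R) (i : I) (A : set R) (k : I) :=
  if k == i then A else B k.

Let measurable_upd B i A : (forall i, measurable (B i)) -> measurable A ->
  forall k, measurable (upd B i A k).
Proof. by move=> mB mA k; rewrite /upd; case: ifP. Qed.

Let cyl_upd (K : {set I}) B i A : i \notin K ->
  cyl (i |: K) (upd B i A) = (X i @^-1` A) `&` cyl K B.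
Proof.
move=> iK; apply/seteqP; split=> w /=.
- move=> h; split; first by have := h i (setU11 _ _); rewrite /upd eqxx.
  move=> k kK; have := h k; rewrite in_setU1 kK orbT /upd => /(_ isT).
  by case: eqP => // ki; rewrite -ki kK in iK.
- move=> [hA hB] k; rewrite in_setU1 /upd; case: eqP => [->//|_] /= kK.
  exact: hB.
Qed.

Let P_cyl_upd (K : {set I}) B i A : i \notin K ->
  (forall i, measurable (B i)) -> measurable A ->
  P ((X i @^-1` A) `&` cyl K B) = (normal_prob (m i) (s i) A * P (cyl K B))%E.
Proof.
move=> iK mB mA; rewrite -cyl_upd// [LHS]indepX; last exact: measurable_upd.
rewrite big_setU1//= /upd eqxx -lawX//; congr (_ * _)%E.
rewrite [RHS]indepX//; apply: eq_bigr => k kK.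
by case: eqP => // ki; rewrite -ki kK in iK.
Qed.

(* The induction adds one variable [X i] to the sum [S]; carrying the event
   [cyl K B] along is what makes [X i] independent of [S] available from the
   induction hypothesis (applied to [i |: K]). *)
Let sum_law (r : seq I) : r != [::] -> uniq r ->
  forall (K : {set I}) B A, {in r, forall i, i \notin K} ->
  (forall i, measurable (B i)) -> measurable A ->
  P ([set w | A (\sum_(i <- r) X i w)] `&` cyl K B) =
  (normal_prob (\sum_(i <- r) m i) (Num.sqrt (\sum_(i <- r) s i ^+ 2)) A
   * P (cyl K B))%E.
Proof.
elim: r => // i r ih _ /= /andP[ir ur] K B A rK mB mA.
have iK : i \notin K by apply: rK; rewrite mem_head.
have [r0|r0] := eqVneq r [::].
  rewrite r0 !big_seq1; under eq_set do rewrite big_seq1.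
  have sE : s i ^+ 2 = Num.sqrt (s i ^+ 2) ^+ 2 by rewrite sqr_sqrtr// sqr_ge0.
  rewrite -(eq_normal_prob _ _ _ _ sE).
  exact: P_cyl_upd.
pose S w := \sum_(j <- r) X j w.
have mS : measurable_fun setT S by exact: measurable_sum.
pose T w : measurableTypeR R * measurableTypeR R := (X i w, S w).
have mT : measurable_fun setT T.
  have mXi : measurable_fun setT (X i) by [].
  exact: measurable_fun_pair mXi mS.
have mC := measurable_cyl K B mB.
(* The law of [(X i, S)] on the cylinder has mass [P (cyl K B)], in general not one; hence the scale
   factor [c]. *)
pose nu := pushforward (mrestr P mC) T.
have c0 : 0 <= fine (P (cyl K B)) by exact: fine_ge0.
pose c := NngNum c0.
have cE : (c%:num)%:E = P (cyl K B) by rewrite /= fineK ?fin_num_measure.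
set s2 := \sum_(j <- r) s j ^+ 2.
(* Since [r] is nonempty here, [S] has a nonzero standard deviation, as the convolution requires. *)
have s2_gt0 : 0 < s2.
  rewrite /s2; case: r r0 {ih ir ur rK S mS T mT nu s2} => // j r _.
  rewrite big_cons; apply: ltr_pwDl; first by rewrite exprn_even_gt0/=.
  by apply: sumr_ge0 => k _; exact: sqr_ge0.
set ms := \sum_(j <- r) m j.
have nuE A1 A2 : measurable A1 -> measurable A2 ->
    nu (A1 `*` A2) =
    (mscale c (normal_prob (m i) (s i)) A1 * normal_prob ms (Num.sqrt s2) A2)%E.
  move=> mA1 mA2.
  have -> : nu (A1 `*` A2) =
      P ([set w | A2 (S w)] `&` cyl (i |: K) (upd B i A1)).
    by rewrite cyl_upd// setIA [X in P (X `&` _)]setIC.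
  rewrite ih//; last 2 first.
  - move=> j jr; rewrite in_setU1 negb_or; apply/andP; split.
      by apply: contraNneq ir => <-.
    by apply: rK; rewrite inE jr orbT.
  - exact: measurable_upd.
  rewrite cyl_upd// P_cyl_upd// muleC /mscale cE; congr (_ * _)%E.
  by rewrite muleC.
have mE : measurable [set z : R * R | A (z.1 + z.2)].
  rewrite -[X in measurable X]setTI.
  by apply: (@measurable_funD _ _ _ _ fst snd).
transitivity (nu [set z | A (z.1 + z.2)]).
  rewrite /nu /pushforward /mrestr; congr (P (_ `&` _)).
  by apply/funext => w; rewrite /= big_cons.
(* Agreement on rectangles, given by [nuE], identifies [nu] with the product measure. *)
rewrite -[LHS](@product_measure_unique _ _ _ _ _
  (mscale c (normal_prob (m i) (s i))) (normal_prob ms (Num.sqrt s2))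
  (pushforward (mrestr P mC) T))//.
rewrite [LHS]ge0_integral_mscale//; last exact: measurable_fun_xsection.
rewrite cE muleC; congr (_ * _)%E.
have s2_neq0 : Num.sqrt s2 != 0 by rewrite gt_eqF ?sqrtr_gt0.
have := normal_prob_convolution (m i) (s i) ms _ A (s_neq0 i) s2_neq0 mA.
have -> : Num.sqrt s2 ^+ 2 = s2 by rewrite sqr_sqrtr// ltW.
rewrite big_cons [\sum_(j <- i :: r) s j ^+ 2]big_cons => <-.
by [].
Qed.

Lemma distribution_sum_normal (A : set R) : (0 < #|I|)%N -> measurable A ->
  P [set w | A (\sum_i X i w)] =
  normal_prob (\sum_i m i) (Num.sqrt (\sum_i s i ^+ 2)) A.
Proof.
move=> I0 mA.
pose r := index_enum I.
have r0 : r != [::].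
  have /card_gt0P[i _] := I0.
  by apply: (contraTneq _ (mem_index_enum i)) => /= r0; rewrite -/r r0.
have := sum_law r r0 (index_enum_uniq I) finset.set0 (fun=> setT) A.
(* With no index constrained, the cylinder is the whole space. *)
have -> : cyl finset.set0 (fun=> setT) = setT by apply/seteqP; split.
by rewrite setIT probability_setT mule1; apply => // i _;
  rewrite finset.in_set0.
Qed.

End sum_of_independent_normals.

(** * Superlevel sets of the statistic *)

Section L_FO_superlevel.
Context {R : realType}.
Variables (N : nat) (mu sigma zstar gamma : R).
Hypotheses (N_gt1 : (1 < N)%N) (sigma_gt0 : 0 < sigma).
Hypothesis gamma_le : gamma <= gamma_max N mu sigma zstar.

Let ln_arg : 1 - N%:R^-1 = (N%:R - 1) / N%:R :> R.
Proof. by rewrite mulrBl divff ?div1r// pnatr_eq0 -lt0n ltnW. Qed.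

(** The bound [gamma_le] makes the radicand nonnegative, so the square root is not truncated to
    zero. *)
Lemma b_T_sqr : b_T N mu sigma zstar gamma ^+ 2 =
  (N%:R - 1) * (mstar mu sigma zstar - ln (1 - N%:R^-1) - 2 * gamma).
Proof.
rewrite sqr_sqrtr// mulr_ge0 ?subr_ge0 ?ler1n 1?ltnW// ln_arg.
by move: gamma_le; rewrite /gamma_max /mstar; lra.
Qed.

(* Completing the square:
   L_FO = gamma_max - N (W - (zstar - mu))^2 / (2 (N - 1) sigma^2). *)
Lemma L_FO_ge W : (gamma <= L_FO N mu sigma zstar W) =
  (`|(W - (zstar - mu)) * (Num.sqrt N%:R / sigma)|
   <= b_T N mu sigma zstar gamma).
Proof.
have N1 : 0 < N%:R - 1 :> R by rewrite subr_gt0 ltr1n.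
have N0 : 0 < N%:R :> R by rewrite ltr0n ltnW.
rewrite -[RHS]ler_sqr ?nnegrE ?sqrtr_ge0// b_T_sqr real_normK ?num_real//.
rewrite exprMn [(_ / _) ^+ 2]exprMn exprVn sqr_sqrtr ?(ltW N0)// ln_arg.
rewrite -[in RHS]ler_pdivrMl// -subr_ge0 -[in RHS]subr_ge0.
(* Half the difference of the two sides is exactly [L_FO] minus [gamma]. *)
rewrite -[in RHS](pmulr_rge0 _ (_ : 0 < 2^-1)) ?invr_gt0//.
congr (0 <= _); rewrite /L_FO /mstar; field.
by rewrite !gt_eqF.
Qed.

End L_FO_superlevel.

(** * Interval probabilities and the Type I error *)

Lemma normal_prob_itvcc {R : realType} (a b : R) : a <= b ->
  normal_prob 0 1 `[a, b]%classic = (Phi b - Phi a)%:E.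
Proof.
move=> ab.
have fin (A : set R) : measurable A -> normal_prob (0 : R) 1 A \is a fin_num.
  by move=> mA; exact: fin_num_measure.
(* The normal law is dominated by Lebesgue measure, so the closed left endpoint carries no mass. *)
have a0 : normal_prob (0 : R) 1 [set a] = 0%E.
  have /null_content_dominatesP := @normal_prob_dominates R 0 1.
  by apply => //; exact: lebesgue_measure_set1.
rewrite EFinB /Phi !fineK ?fin//.
rewrite -(@setU1itv _ _ _ a false) ?bnd_simp// measureU//=; last first.
  by apply/seteqP; split=> x //= [->]; rewrite in_itv/= ltxx.
rewrite a0 add0e.
have -> : `]-oo, b]%classic = `]-oo, a] `|` `]a, b]%classic :> set R.
  by rewrite -itv_bndbnd_setU.
rewrite measureU//=; last first.
  apply/seteqP; split=> x //=; rewrite !in_itv/= => -[xa /andP[]].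
  by rewrite ltNge xa.
by rewrite [X in (X - _)%E]addeC addeK ?fin.
Qed.

Theorem lemma3p7 (R : realType) (d : measure_display) (Omega : measurableType d)
  (P : probability Omega R) (T n : nat) (mu sigma zstar gamma : R)
  (X : 'I_T * 'I_n -> {RV P >-> R}) :
  (1 <= T)%N -> (1 <= n)%N -> (2 <= n * T)%N -> 0 < sigma ->
  (* H0: the X_{t,k} are i.i.d. N(mu, sigma^2) *)
  mutually_independent X ->
  (forall i (A : set R), measurable A ->
     distribution P (X i) A = normal_prob mu sigma A) ->
  gamma <= gamma_max (n * T) mu sigma zstar ->
  P [set w | gamma <= L_FO (n * T) mu sigma zstar (muhat X w - mu)] =
  (Phi (a_T (n * T) mu sigma zstar + b_T (n * T) mu sigma zstar gamma)
   - Phi (a_T (n * T) mu sigma zstar - b_T (n * T) mu sigma zstar gamma))%:E.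
Proof.
move=> _ _ N2 sigma_gt0 indepX lawX gamma_le.
set N := (n * T)%N in N2 gamma_le *.
set a := a_T _ _ _ _; set b := b_T _ _ _ _ _.
have N0 : 0 < N%:R :> R by rewrite ltr0n ltnW.
pose sN : R := Num.sqrt N%:R.
have sN0 : 0 < sN by rewrite sqrtr_gt0.
have sNE : sN ^+ 2 = N%:R by rewrite sqr_sqrtr// ltW.
(* A negative standard deviation reflects the law, so that the centre of the
   interval becomes [a] whatever the sign of [zstar - mu]. *)
pose e : R := (-1) ^+ (zstar - mu < 0)%R.
have e2 : e ^+ 2 = 1 by rewrite sqrr_sign.
have e0 : e != 0 by rewrite signr_eq0.
(* Signed standard deviation of the sum of all [N] observations. *)
pose s := e * (sN * sigma).
have s0 : s != 0 by rewrite !mulf_neq0// gt_eqF.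
have aE : a = e * (zstar - mu) * (sN / sigma).
  rewrite /a /a_T /mstar sqrtrM ?divr_ge0 ?sqr_ge0// -/sN -exprVn -exprMn.
  rewrite sqrtr_sqr normrM normfV (gtr0_norm sigma_gt0) -normrEsign.
  by rewrite mulrAC mulrA.
have b0 : 0 <= b by exact: sqrtr_ge0.
have card_idx : #|{: 'I_T * 'I_n}| = N by rewrite card_prod !card_ord mulnC.
(* The event is phrased for the sum rather than the mean, to match [distribution_sum_normal]. *)
pose A : set R := (fun x => (x - N%:R * mu) / s) @^-1` `[a - b, a + b]%classic.
have mA : measurable A.
  rewrite -[A]setTI /A; apply: (_ : measurable_fun setT _) => //.
  by apply: measurable_funM => //; exact: measurable_funB.
have distE x : `|(N%:R^-1 * x - mu - (zstar - mu)) * (sN / sigma)| =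
    `|(x - N%:R * mu) / s - a|.
  (* Multiplying by [e] keeps the absolute value and cancels the sign in both [s] and [a]. *)
  transitivity `|e * ((x - N%:R * mu) / s - a)|; last first.
    by rewrite normrM normr_sign mul1r.
  congr `|_|; rewrite aE /s mulrBr [e * (e * _ * _)]mulrA [e * (e * _)]mulrA.
  rewrite -expr2 e2 mul1r -sNE.
  by field; rewrite e0 !gt_eqF.
transitivity (P [set w | A (\sum_i X i w)]).
  congr (P _); apply/seteqP; split=> w /=;
    by rewrite (L_FO_ge N mu sigma zstar gamma)// -/b /A/= in_itv/= -ler_distl
      distE.
rewrite (@distribution_sum_normal _ _ _ _ _ X (fun=> mu) (fun=> sigma))//.
- have sumE (x : R) : \sum_(i : 'I_T * 'I_n) x = N%:R * x.
    by rewrite sumr_const card_idx mulr_natl.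
  have sE : Num.sqrt (N%:R * sigma ^+ 2) ^+ 2 = s ^+ 2.
    rewrite sqr_sqrtr ?(mulr_ge0 (ltW N0) (sqr_ge0 sigma))//.
    by rewrite /s exprMn e2 mul1r exprMn sNE.
  rewrite /= !sumE (eq_normal_prob _ _ _ _ sE) -normal_prob_itvcc; last by lra.
  exact: normal_prob_standardize.
- by move=> i; rewrite gt_eqF.
- by rewrite card_idx ltnW.
Qed.
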